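(* For any positive integers $k\le n$, the function $\mathtt{notEXACT}^k_n$ is computed by an NUOBDD of width 2.
   Context: $\mathtt{notEXACT}^k_n:\{0,1\}^n\to\{0,1\}$ is $0$ iff the input contains exactly $k$ ones, and $1$ otherwise. A unitary OBDD (UOBDD) of width $d$ on $n$ variables is $(Q,|\psi^0\rangle,T,Q_{acc})$: $Q=\{q_1,\dots,q_d\}$ indexes an orthonormal basis of $\mathbb{C}^d$, $|\psi^0\rangle$ a unit vector, $Q_{acc}\subseteq Q$, $T=((i_j,U_j(0),U_j(1)))_{j=1}^n$ with $(i_1,\dots,i_n)$ a permutation of $\{1,\dots,n\}$ and $U_j(b)$ unitary $d\times d$ matrices. On input $\sigma$ the final state is $|\psi^n\rangle=U_n(\sigma_{i_n})\cdots U_1(\sigma_{i_1})|\psi^0\rangle$ and the acceptance probability is $\|P_{acc}|\psi^n\rangle\|^2$ with $P_{acc}$ the projection onto the span of accepting basis states. An NUOBDD computes $f$ if for all $\sigma$: $f(\sigma)=1$ iff the acceptance probability is nonzero. *)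

(* Defs.v *)
From mathcomp Require Import all_boot all_order perm all_algebra.
From mathcomp Require Import reals complex.

Set Implicit Arguments.
Unset Strict Implicit.
Unset Printing Implicit Defensive.

Import Num.Theory.
Local Open Scope ring_scope.

Definition l2norm (R : realType) (d : nat) (v : 'cV[R[i]]_d) : R[i] :=
  sqrtC (\sum_(i < d) `|v i ord0| ^+ 2).

(* The basis indexed by Q is the standard basis of C^d, so Q is 'I_d. *)
Record uobdd (R : realType) (d n : nat) := UOBDD {
  init_state : 'cV[R[i]]_d;
  acc_states : {set 'I_d};
  var_order : {perm 'I_n};
  transition : 'I_n -> bool -> 'M[R[i]]_d;
  init_state_unit : l2norm init_state = 1;
  transition_unitary : forall (j : 'I_n) (b : bool),
    transition j b \is unitarymx
}.

(* [enum 'I_n] is increasing, so the factor for j = 0 is applied first. *)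
Definition final_state (R : realType) (d n : nat) (P : uobdd R d n)
    (s : n.-tuple bool) : 'cV[R[i]]_d :=
  foldl (fun psi j => transition P j (tnth s (var_order P j)) *m psi)
        (init_state P) (enum 'I_n).

Definition acc_proj (R : realType) (d n : nat) (P : uobdd R d n) : 'M[R[i]]_d :=
  \matrix_(i < d, j < d) ((i == j) && (i \in acc_states P))%:R.

Definition acc_prob (R : realType) (d n : nat) (P : uobdd R d n)
    (s : n.-tuple bool) : R[i] :=
  l2norm (acc_proj P *m final_state P s) ^+ 2.

Definition nuobdd_computes (R : realType) (d n : nat) (P : uobdd R d n)
    (f : n.-tuple bool -> bool) : Prop :=
  forall s : n.-tuple bool, f s = true <-> acc_prob P s <> 0.

Definition notEXACT (k n : nat) (s : n.-tuple bool) : bool :=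
  count_mem true s != k.

(* Main.v *)
(* Let z be a primitive (n+1)-th root of unity. The unitary M(w), with rows
   ((1 + w)/2, (1 - w)/2) and ((1 - w)/2, (1 + w)/2), is diag(1, w) written in
   the basis (1, 1), (1, -1), so M is multiplicative in w. Reading a one applies
   M(z), reading a zero applies the identity, and the initial state is the first
   column of M(z^-k). If the input has m ones, the amplitude of the second basis
   state is finally (1 - z^(m - k))/2, which vanishes iff m = k, because both m
   and k are at most n. *)
Require Import Defs.
From mathcomp Require Import all_boot all_order perm all_algebra.
From mathcomp Require Import reals complex.
From mathcomp Require Import separable cyclotomic cyclic ring.

Set Implicit Arguments.
Unset Strict Implicit.
Unset Printing Implicit Defensive.

Import GRing.Theory Num.Theory.
Local Open Scope ring_scope.
Local Open Scope sesquilinear_scope.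

(** In characteristic 0 the polynomial ['X^n - 1] is separable, so it splits into [n] distinct
    linear factors; [n] distinct [n]-th roots of unity in a field always include a primitive one. *)
Lemma prim_root_exists (C : numClosedFieldType) (n : nat) :
  (0 < n)%N -> exists z : C, n.-primitive_root z.
Proof.
move=> n_gt0; have [rs] := closed_field_poly_normal ('X^n - 1 : {poly C}).
rewrite lead_coefXnsubC // scale1r => Xn1E.
have /hasP[z _ z_prim] : has n.-primitive_root rs; last by exists z.
apply: has_prim_root => //.
- by apply/allP => x; rewrite -root_prod_XsubC -Xn1E.
- rewrite -separable_prod_XsubC -Xn1E.
  by apply: separable_Xn_sub_1; rewrite pnatr_eq0 -lt0n.
- by rewrite -ltnS -(size_prod_XsubC rs id) -Xn1E size_XnsubC.
Qed.

Lemma norm_prim_root (C : numClosedFieldType) (n : nat) (z : C) :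
  n.-primitive_root z -> `|z| = 1.
Proof.
move=> z_prim; apply/eqP; rewrite -(@pexpr_eq1 _ _ n) ?normr_ge0 //.
  by rewrite -normrX (prim_expr_order z_prim) normr1.
exact: prim_order_gt0 z_prim.
Qed.

Lemma prod_if_exp (R : comNzRingType) (n : nat) (s : n.-tuple bool) (z : R) :
  \prod_(j <- enum 'I_n) (if tnth s j then z else 1) = z ^+ count_mem true s.
Proof.
(* Both sides now range over [enum 'I_n], which can be generalised to any list of indices. *)
rewrite -[in RHS](map_tnth_enum s) count_map.
elim: (enum 'I_n) => [|j js IHjs] /=; first by rewrite big_nil.
by rewrite big_cons IHjs exprD /= eqb_id; case: (tnth s j); rewrite ?expr0 ?mul1r.
Qed.

Section PhaseMatrix.
Variable C : numClosedFieldType.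

Definition phase_mx (w : C) : 'M[C]_2 :=
  \matrix_(i, j) (if i == j then (1 + w) / 2 else (1 - w) / 2).

Lemma phase_mx1 : phase_mx 1 = 1%:M.
Proof.
by apply/matrixP => i j; rewrite !mxE subrr mul0r; case: eqP => //= _; field.
Qed.

Lemma phase_mxM (w w' : C) : phase_mx w *m phase_mx w' = phase_mx (w * w').
Proof.
apply/matrixP => i j; rewrite !mxE !big_ord_recl big_ord0 !mxE.
by case: i => [[|[|i]] //= ?]; case: j => [[|[|j]] //= ?]; field.
Qed.

(** Since the matrix is symmetric, its adjoint is [phase_mx w^*], and multiplicativity reduces the
    claim to [w * w^* = 1]. *)
Lemma phase_mx_unitary (w : C) : `|w| = 1 -> phase_mx w \is unitarymx.
Proof.
move=> w1; apply/unitarymxP.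
have -> : phase_mx w ^t* = phase_mx w^*.
  apply/matrixP => i j; rewrite !mxE eq_sym; case: eqP => _ /=;
  by rewrite rmorphM /= (rmorphB, rmorphD) /= rmorph1 fmorphV rmorph_nat.
by rewrite phase_mxM -normCK w1 expr1n phase_mx1.
Qed.

End PhaseMatrix.

Lemma unitary_col_l2norm (R : realType) (d : nat) (M : 'M[R[i]]_d) (j : 'I_d) :
  M \is unitarymx -> l2norm (col j M) = 1.
Proof.
move=> M_unitary; rewrite /l2norm.
(* [unitarymxP] gives orthonormal rows, hence the passage to the transpose to reach columns. *)
have /unitarymxP/matrixP/(_ j j) : M^T \is unitarymx by rewrite trmx_unitary.
rewrite !mxE eqxx /= => Mj; rewrite -[RHS]sqrtC1 -[X in _ = sqrtC X]Mj; congr sqrtC.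
by apply: eq_bigr => i _; rewrite !mxE normCK.
Qed.

Lemma acc_prob_set1 (R : realType) (d n : nat) (P : uobdd R d n)
    (i : 'I_d) (s : n.-tuple bool) :
  acc_states P = [set i] -> acc_prob P s = `|final_state P s i ord0| ^+ 2.
Proof.
move=> accP; have projE l : (acc_proj P *m final_state P s) l ord0 =
    (l == i)%:R * final_state P s i ord0.
  rewrite mxE (bigD1 i) //= big1 => [|j ji]; rewrite !mxE accP inE.
    by rewrite andbb addr0.
  by case: eqP => [->|_]; rewrite ?(negPf ji) mul0r.
rewrite /acc_prob /l2norm sqrtCK (bigD1 i) //= big1 => [|j ji].
  by rewrite projE eqxx mul1r addr0.
by rewrite projE (negPf ji) mul0r normr0 expr0n.
Qed.

Section ExactAutomaton.
Variables (R : realType) (k n : nat) (z : R[i]).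
Hypothesis z1 : `|z| = 1.

Let phase (b : bool) : R[i] := if b then z else 1.

Let normXV : `|z ^- k| = 1.
Proof. by rewrite normfV normrX z1 expr1n invr1. Qed.

Let norm_phase b : `|phase b| = 1.
Proof. by case: b => //=; rewrite normr1. Qed.

Definition exact_uobdd : uobdd R 2 n := {|
  init_state := col ord0 (phase_mx (z ^- k));
  acc_states := [set ord_max];
  var_order := 1%g;
  transition := fun _ b => phase_mx (phase b);
  init_state_unit := unitary_col_l2norm ord0 (phase_mx_unitary normXV);
  transition_unitary := fun _ b => phase_mx_unitary (norm_phase b) |}.

Lemma final_state_exact (s : n.-tuple bool) :
  final_state exact_uobdd s =
  col ord0 (phase_mx (z ^+ count_mem true s * z ^- k)).
Proof.
rewrite /final_state /= -prod_if_exp.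
(* The starting phase [z ^- k] is generalised to [w], because each letter read multiplies it. *)
elim: (enum 'I_n) (z ^- k) => [|j js IHjs] w /=; first by rewrite big_nil mul1r.
by rewrite perm1 colE mulmxA phase_mxM -colE IHjs big_cons mulrCA mulrA.
Qed.

Lemma acc_prob_exact (s : n.-tuple bool) :
  (acc_prob exact_uobdd s == 0) = (z ^+ count_mem true s == z ^+ k).
Proof.
rewrite (acc_prob_set1 (i := ord_max)) // final_state_exact !mxE /=.
have zk0 : z ^+ k != 0 by rewrite -normr_eq0 normrX z1 expr1n oner_eq0.
(* The amplitude is off the diagonal, so it vanishes iff its phase is 1; multiplying by [z ^+ k]
   then clears the inverse. *)
rewrite expf_eq0 normr_eq0 mulf_eq0 invr_eq0 pnatr_eq0 orbF subr_eq0.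
by rewrite -(inj_eq (mulIf zk0)) mul1r divfK // eq_sym.
Qed.

End ExactAutomaton.

Local Close Scope ring_scope.

Theorem theorem8 (R : realType) (k n : nat) (hk : 0 < k) (hkn : k <= n) :
  exists P : uobdd R 2 n, nuobdd_computes P (@notEXACT k n).
Proof.
have [z z_prim] := @prim_root_exists R[i] n.+1 isT.
exists (exact_uobdd k n (norm_prim_root z_prim)) => s; rewrite /notEXACT.
have count_le : count_mem true s <= n by rewrite -{2}(size_tuple s) count_size.
have <- : (acc_prob (exact_uobdd k n (norm_prim_root z_prim)) s == 0)%R
    = (count_mem true s == k).
  (* Equal powers of [z] mean exponents congruent modulo [n.+1], and both exponents lie below
     [n.+1]. *)
  by rewrite acc_prob_exact (eq_prim_root_expr z_prim) !modn_small.
by split=> /eqP.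
Qed.
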